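(* Let $\mathcal{H}=\{rrr,rrb\}$. Then, for every integer $n\ge 2$, $f(n)\le h_2(n,\mathcal{H})\le 2f(n)$.
   Context: Edge-colorings of the complete graph $K_n$ use colors from $\{r,b,y\}$ (red, blue, yellow); they need not be proper, and not all colors need be used. A pattern is an edge-colored triangle, denoted by the multiset of the colors of its three edges; e.g. $rrr$ is the all-red triangle and $rrb$ is the triangle with two red edges and one blue edge. For a family $\mathcal{H}$ of patterns, $\operatorname{Forb}(n,\mathcal{H})$ is the set of all edge-colorings of $K_n$ with colors from $\{r,b,y\}$ in which no triangle has a coloring belonging to $\mathcal{H}$. For an edge-coloring $c$ of $K_n$, $h_2(c)$ is the maximum $k$ such that there is a set of $k$ vertices whose induced edges use at most two of the three colors. Finally, $h_2(n,\mathcal{H})=\min\{h_2(c): c\in\operatorname{Forb}(n,\mathcal{H})\}$. For a graph $G$, $\alpha(G)$ and $\omega(G)$ denote the independence number and the clique number, and $G^2$ is the square of $G$: the graph on the same vertex set in which two distinct vertices are adjacent if and only if they are at distance at most $2$ in $G$. Define $f(G)=\max\{\alpha(G),\omega(G^2)\}$ and $f(n)=\min\{f(G): |V(G)|=n,\ \omega(G)=2\}$. *)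

(* Defs.v *)
From HB Require Import structures.
From mathcomp Require Import all_boot.

Set Implicit Arguments.
Unset Strict Implicit.
Unset Printing Implicit Defensive.

Inductive color := Red | Blue | Yellow.

Definition color_code (k : color) : option bool :=
  match k with Red => Some true | Blue => Some false | Yellow => None end.

Definition color_decode (x : option bool) : color :=
  match x with Some true => Red | Some false => Blue | None => Yellow end.

Lemma color_codeK : cancel color_code color_decode. Proof. by case. Qed.

HB.instance Definition _ := Finite.copy color (can_type color_codeK).

(* The edges of the complete graph on T. *)
Notation edge T := {e : {set T} | #|e| == 2}.

Notation coloring T := {ffun edge T -> color}.

(* A pattern is a multiset of three colors: a triple read up to perm_eq. *)
Notation pattern := (3.-tuple color).

(* A simple graph on the vertex set T is its set of edges. *)
Notation graph T := {set edge T}.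

Section Colorings.

Variable T : finType.

Definition triangle_colors (c : coloring T) (t : {set T}) : seq color :=
  [seq c e | e : edge T in [pred e : edge T | val e \subset t]].

Definition avoids (H : seq pattern) (c : coloring T) : bool :=
  [forall t : {set T}, (#|t| == 3) ==>
     ~~ has (fun p : pattern => perm_eq (triangle_colors c t) p) H].

Definition colors_on (c : coloring T) (S : {set T}) : {set color} :=
  [set c e | e : edge T & val e \subset S].

Definition h2_coloring (c : coloring T) : nat :=
  \max_(S : {set T} | #|colors_on c S| <= 2) #|S|.

End Colorings.

Definition Forb (n : nat) (H : seq pattern) : {set coloring 'I_n} :=
  [set c | avoids H c].

(* The minimum of h2_coloring over Forb n H; as h2_coloring c <= n always, the
   default n matters only when Forb n H is empty (cf. h2_attained and
   Forb_rrr_rrb_neq0 below). *)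
Definition h2 (n : nat) (H : seq pattern) : nat :=
  \big[minn/n]_(c in Forb n H) h2_coloring c.

Section Graphs.

Variable T : finType.

Definition adj (G : graph T) : rel T :=
  fun x y => [exists e in G, val e == [set x; y]].

Definition independent (G : graph T) (S : {set T}) : bool :=
  [forall e : edge T, (val e \subset S) ==> (e \notin G)].

Definition clique (G : graph T) (S : {set T}) : bool :=
  [forall e : edge T, (val e \subset S) ==> (e \in G)].

Definition alpha (G : graph T) : nat := \max_(S | independent G S) #|S|.

Definition omega (G : graph T) : nat := \max_(S | clique G S) #|S|.

(* x and y are at distance at most k: some walk of length m <= k joins them. *)
Definition dist_le (G : graph T) (k : nat) (x y : T) : bool :=
  [exists m : 'I_k.+1, exists p : m.-tuple T,
     path (adj G) x p && (last x p == y)].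

Definition square (G : graph T) : graph T :=
  [set e : edge T | [forall x in val e, forall y in val e, dist_le G 2 x y]].

Definition f_graph (G : graph T) : nat := maxn (alpha G) (omega (square G)).

End Graphs.

(* As f_graph G <= n always, the default n matters only when no graph on n
   vertices has clique number 2, i.e. when n < 2 (cf. f_attained below). *)
Definition f (n : nat) : nat :=
  \big[minn/n]_(G : graph 'I_n | omega G == 2) f_graph G.

Definition rrr : pattern := [tuple Red; Red; Red].
Definition rrb : pattern := [tuple Red; Red; Blue].

Lemma bigminn_attained (I : finType) (P : pred I) (F : I -> nat) (n : nat) :
    (exists i, P i) -> (forall i, F i <= n) ->
  exists2 i, P i & \big[minn/n]_(j | P j) F j = F i
                   /\ forall j, P j -> F i <= F j.
Proof.
move=> [i0 Pi0] Fn; case: (arg_minnP F Pi0) => i Pi Hi.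
exists i => //; split=> //; apply/eqP; rewrite eqn_leq; apply/andP; split.
  have: i \in index_enum I by rewrite mem_index_enum.
  elim: (index_enum I) => // j r IHr; rewrite inE big_cons.
  case/predU1P => [<-|/IHr le_i]; first by rewrite Pi geq_minl.
  by case: ifP => // _; rewrite geq_min le_i orbT.
by elim/big_ind: _ => [|x y Hx Hy|j Pj]; rewrite ?leq_min ?Hx ?Hy ?Fn ?Hi.
Qed.

Lemma h2_attained n H : Forb n H != set0 ->
  exists2 c : coloring 'I_n, c \in Forb n H & h2 n H = h2_coloring c
                   /\ forall c' : coloring 'I_n,
                     c' \in Forb n H -> h2_coloring c <= h2_coloring c'.
Proof.
move=> /set0Pn HF; apply: bigminn_attained => // c.
by apply/bigmax_leqP => S _; rewrite -[leqRHS]card_ord max_card.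
Qed.

Lemma Forb_rrr_rrb_neq0 n : Forb n [:: rrr; rrb] != set0.
Proof.
apply/set0Pn; exists [ffun=> Yellow]; rewrite inE.
apply/forallP => t; apply/implyP => _; rewrite -all_predC.
apply/allP => p p_in; apply/negP => /perm_mem/(_ Red).
have -> : Red \in p by move: p_in; rewrite !inE => /orP[]/eqP->.
by move=> /mapP[e _]; rewrite ffunE.
Qed.

Lemma f_attained n : 2 <= n ->
  exists2 G : graph 'I_n, omega G == 2 & f n = f_graph G
                   /\ forall G' : graph 'I_n,
                     omega G' == 2 -> f_graph G <= f_graph G'.
Proof.
case: n => [|[|n]] // _; apply: bigminn_attained; last first.
  have le_n (S : {set 'I_n.+2}) : #|S| <= n.+2.
    by rewrite -[leqRHS]card_ord max_card.
  by move=> G; rewrite geq_max; apply/andP; split; apply/bigmax_leqP.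
have xy2 : #|[set ord0; ord_max : 'I_n.+2]| == 2 by rewrite cards2.
pose e : edge 'I_n.+2 := exist (fun s : {set 'I_n.+2} => #|s| == 2) _ xy2.
exists [set e]; rewrite eqn_leq; apply/andP; split.
  apply/bigmax_leqP => S /forallP cS; rewrite leqNgt; apply/negP => S3.
  have /subset_leq_card : S \subset val e.
    apply/subsetP => x xS; have : 1 < #|S :\ x|.
      by move: S3; rewrite (cardsD1 x) xS.
    case/card_gt1P => y [_ [yS _ _]].
    have xy : #|[set x; y]| == 2.
      by rewrite cards2; move: yS; rewrite !inE eq_sym => /andP[->].
    have yS' : y \in S by case/setD1P: yS.
    have /implyP := cS (exist (fun s : {set 'I_n.+2} => #|s| == 2) _ xy).
    by rewrite subUset !sub1set xS yS' => /(_ isT)/set1P <-; rewrite set21.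
  by rewrite /= (eqP xy2) leqNgt S3.
apply: leq_trans (leq_bigmax_cond (val e) _); first by rewrite /= (eqP xy2).
apply/forallP => e'; apply/implyP => se'; rewrite inE -val_eqE.
by rewrite eqEcard se' (eqP xy2) (eqP (valP e')).
Qed.

(* Main.v *)
Require Import Defs.
From mathcomp Require Import all_boot.

(* In a coloring avoiding rrr and rrb the red graph G is triangle-free and no
   two vertices at distance at most 2 in G span a blue edge, so that independent
   sets of G miss red and cliques of G^2 miss blue. Conversely, color a
   triangle-free G red, the remaining edges of G^2 yellow and all others blue:
   a set missing red is independent in G, one missing blue is a clique of G^2,
   and in one missing yellow the red edges form a matching, so that at least
   half of its vertices are independent in G. *)

Set Implicit Arguments.
Unset Strict Implicit.
Unset Printing Implicit Defensive.

(** * Edges, distance at most two, clique number two *)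

Section Edges.

Variable T : finType.
Implicit Types (x y z : T) (e : edge T) (G : graph T) (S : {set T}).

Lemma card_triple x y z :
  x != y -> x != z -> y != z -> #|[set x; y; z]| = 3.
Proof.
move=> xy xz yz; rewrite setUC cardsU1 cards2 xy !inE negb_or.
by rewrite ![z == _]eq_sym xz yz.
Qed.

Lemma edgeP x y : x != y -> exists e, val e = [set x; y].
Proof.
move=> xy; have xy2 : #|[set x; y]| == 2 by rewrite cards2 xy.
by exists (exist (fun S : {set T} => #|S| == 2) _ xy2).
Qed.

Lemma edge_neq x y e : val e = [set x; y] -> x != y.
Proof. by move=> exy; have := valP e; rewrite exy cards2; case: (x != y). Qed.

Lemma edge_ends e : exists x y, val e = [set x; y].
Proof. by have /cards2P[x [y [_ exy]]] := valP e; exists x, y. Qed.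

Lemma edge_sub_eq e1 e2 : val e1 \subset val e2 -> e1 = e2.
Proof.
by move=> s12; apply/val_inj/eqP; rewrite eqEcard s12 (eqP (valP e1))
  (eqP (valP e2)).
Qed.

Lemma adjE G e x y : val e = [set x; y] -> adj G x y = (e \in G).
Proof.
move=> exy; apply/existsP/idP => [[e' /andP[e'G /eqP e'xy]]|eG].
  by rewrite (_ : e = e') //; apply: val_inj; rewrite exy e'xy.
by exists e; rewrite eG exy eqxx.
Qed.

Lemma adj_edge G x y : adj G x y -> exists2 e, e \in G & val e = [set x; y].
Proof. by case/existsP => e /andP[eG /eqP exy]; exists e. Qed.

Lemma adj_sym G : symmetric (adj G).
Proof. by move=> x y; apply: eq_existsb => e; rewrite setUC. Qed.

Lemma dist_le2P G x y :
  reflect [\/ x = y, adj G x y | exists2 z, adj G x z & adj G z y]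
          (dist_le G 2 x y).
Proof.
apply: (iffP existsP) => [[m /existsP[[p /= /eqP sp] /andP[pth /eqP lst]]]|].
  case: m p sp pth lst => [[|[|[|//]]]] _ [|u [|v [|//]]] //= _.
  - by constructor 1.
  - by rewrite andbT => xu <-; constructor 2.
  by case/and3P => xu uv _ <-; constructor 3; exists u.
case=> [<-|xy|[z xz zy]].
- by exists ord0; apply/existsP; exists [tuple]; rewrite /= eqxx.
- by exists (inord 1); rewrite inordK //; apply/existsP; exists [tuple y];
    rewrite /= xy eqxx.
by exists (inord 2); rewrite inordK //; apply/existsP; exists [tuple z; y];
  rewrite /= xz zy eqxx.
Qed.

Lemma dist_le2_sym G : symmetric (dist_le G 2).
Proof.
suff s x y : dist_le G 2 x y -> dist_le G 2 y x.
  by move=> x y; apply/idP/idP; apply: s.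
case/dist_le2P => [->|xy|[z xz zy]]; apply/dist_le2P.
- by constructor 1.
- by constructor 2; rewrite adj_sym.
by constructor 3; exists z; rewrite adj_sym.
Qed.

Lemma squareE G e x y : val e = [set x; y] ->
  (e \in square G) = dist_le G 2 x y.
Proof.
move=> exy; rewrite inE exy.
apply/forall_inP/idP => [/(_ x (set21 _ _))/forall_inP|dxy u].
  by move/(_ y (set22 _ _)).
have dd v : dist_le G 2 v v by apply/dist_le2P; constructor 1.
by move=> /set2P[]->; apply/forall_inP => v /set2P[]->;
  rewrite ?dd // dist_le2_sym.
Qed.

Lemma clique_edge G e : e \in G -> clique G (val e).
Proof.
by move=> eG; apply/forallP => e'; apply/implyP => /edge_sub_eq->.
Qed.

Lemma clique_adj G S x y :
  clique G S -> x \in S -> y \in S -> x != y -> adj G x y.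
Proof.
move=> /forall_inP cS xS yS /edgeP[e exy]; rewrite (adjE _ exy).
by apply: cS; rewrite exy subUset !sub1set xS.
Qed.

Lemma independent_adj G S :
  {in S &, forall x y, ~~ adj G x y} -> independent G S.
Proof.
move=> nS; apply/forall_inP => e.
have [x [y exy]] := edge_ends e; rewrite exy subUset !sub1set.
by case/andP => xS yS; rewrite -(adjE G exy) nS.
Qed.

(** A single edge is a clique of size 2, which gives [2 <= omega G]; any three vertices of a larger
    clique form a triangle, which gives [omega G <= 2]. *)
Lemma omega_eq2P G :
  reflect (G != set0 /\ forall x y z, adj G x y -> adj G y z -> ~~ adj G x z)
          (omega G == 2).
Proof.
apply: (iffP idP) => [/eqP om|[/set0Pn[e eG] tf]].
  have maxG S : clique G S -> #|S| <= 2.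
    by move=> cS; rewrite -om; apply: leq_bigmax_cond.
  split.
    apply/eqP => G0; suff: omega G <= 1 by rewrite om.
    apply/bigmax_leqP => S cS; rewrite leqNgt.
    apply/negP => /card_gt1P[x [y [xS yS xy]]].
    by have /adj_edge[e] := clique_adj cS xS yS xy; rewrite G0 inE.
  move=> x y z xy yz; apply/negP => xz.
  have [[e eG exy] [e' eG' eyz]] := (adj_edge xy, adj_edge yz).
  have [e'' eG'' exz] := adj_edge xz.
  suff: clique G [set x; y; z].
    move/maxG.
    by rewrite card_triple ?(edge_neq exy, edge_neq exz, edge_neq eyz).
  apply/forall_inP => d; have [u [v duv]] := edge_ends d.
  rewrite -(adjE G duv) duv subUset !sub1set !inE -!orbA.
  have := edge_neq duv => /[swap].
  by case/andP => /or3P[]/eqP-> /or3P[]/eqP->; rewrite ?eqxx // adj_sym.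
rewrite eqn_leq; apply/andP; split.
  apply/bigmax_leqP => S cS; rewrite leqNgt; apply/negP => /card_gt2P.
  case=> x [y [z [[xS yS zS] [xy yz zx]]]].
  have := tf x y z (clique_adj cS xS yS xy) (clique_adj cS yS zS yz).
  by rewrite (clique_adj cS xS zS) // eq_sym.
apply: leq_trans (leq_bigmax_cond _ (clique_edge eG)).
by rewrite (eqP (valP e)).
Qed.

End Edges.

(** * Colorings and their red graphs *)

Section RedGraph.

Variable T : finType.
Implicit Types (x y z : T) (e : edge T) (c : coloring T) (S : {set T}).

(** The colors come in the enumeration order of the edges, which is opaque; a permutation suffices,
    since patterns are compared by [perm_eq]. *)
Lemma triangle_colorsE c x y z exy eyz exz :
    val exy = [set x; y] -> val eyz = [set y; z] -> val exz = [set x; z] ->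
  perm_eq (triangle_colors c [set x; y; z]) [:: c exy; c eyz; c exz].
Proof.
move=> Exy Eyz Exz; rewrite -[X in perm_eq _ X]/(map c [:: exy; eyz; exz]).
apply: perm_map; have [xy yz] := (edge_neq Exy, edge_neq Eyz).
have xz := edge_neq Exz.
apply: uniq_perm; first exact: enum_uniq.
  have neq u e e' : u \in val e -> u \notin val e' -> e != e'.
    by move=> ue ue'; apply: contraNneq ue' => <-.
  rewrite /= !inE negb_or andbT -andbA; apply/and3P; split=> //.
  - by apply: (neq x); rewrite ?Exy ?Eyz !inE ?eqxx // negb_or xy.
  - by apply: (neq y); rewrite ?Exy ?Exz !inE ?eqxx ?orbT // negb_or eq_sym xy.
  by apply: (neq y); rewrite ?Eyz ?Exz !inE ?eqxx // negb_or eq_sym xy.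
move=> e; rewrite mem_enum !inE; apply/idP/idP; last first.
  case/or3P => /eqP->; rewrite ?Exy ?Eyz ?Exz.
  - exact: subsetUl.
  - by rewrite -setUA subsetUr.
  by rewrite setUAC subsetUl.
(* Both ends of [e] lie among [x], [y], [z]: of the nine choices, three have equal ends and the
   others give the three listed edges. *)
have [u [v euv]] := edge_ends e; have := edge_neq euv.
rewrite -!val_eqE /= euv Exy Eyz Exz subUset !sub1set !inE -!orbA.
by move=> uv /andP[]/or3P[]/eqP uE /or3P[]/eqP vE; move: uv;
  rewrite uE vE ?eqxx ?orbT // setUC ?eqxx ?orbT.
Qed.

Lemma avoids_rrr_rrbP c :
  reflect (forall x y z exy eyz exz,
    val exy = [set x; y] -> val eyz = [set y; z] -> val exz = [set x; z] ->
    c exy = Red -> c eyz = Red -> c exz = Yellow)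
    (avoids [:: rrr; rrb] c).
Proof.
apply: (iffP forall_inP) => [av x y z exy eyz exz Exy Eyz Exz rxy ryz|av t].
  have := triangle_colorsE c Exy Eyz Exz; rewrite rxy ryz => tE.
  have /av : #|[set x; y; z]| == 3.
    by rewrite card_triple ?(edge_neq Exy, edge_neq Exz, edge_neq Eyz).
  by rewrite /= !(permPl tE); case: (c exz).
move=> /eqP t3; have /card_gt2P : 2 < #|t| by rewrite t3.
case=> x [y [z [[xt yt zt] [xy yz]]]]; rewrite eq_sym => xz.
have tE : [set x; y; z] = t.
  by apply/eqP; rewrite eqEcard !subUset !sub1set xt yt zt t3 card_triple.
have [[exy Exy] [eyz Eyz]] := (edgeP xy, edgeP yz); have [exz Exz] := edgeP xz.
have [Eyx Ezy] : val exy = [set y; x] /\ val eyz = [set z; y].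
  by rewrite Exy Eyz; split; apply: setUC.
have Ezx : val exz = [set z; x] by rewrite Exz setUC.
have := triangle_colorsE c Exy Eyz Exz; rewrite tE => tc.
rewrite /= !(permPl tc).
(* One instance for each vertex at which two red edges can meet: [y], [x], then [z]. *)
have := av _ _ _ _ _ _ Exy Eyz Exz; have := av _ _ _ _ _ _ Eyx Exz Eyz.
have := av _ _ _ _ _ _ Exz Ezy Exy.
by case: (c exy); case: (c eyz); case: (c exz) => // h1 h2 h3;
  by [have := h1 erefl erefl | have := h2 erefl erefl | have := h3 erefl erefl].
Qed.

Lemma card_color : #|{: color}| = 3.
Proof.
rewrite -[3](_ : #|{: option bool}| = 3); last by rewrite card_option card_bool.
apply: (bij_eq_card (f := color_code)).
by exists color_decode; [apply: color_codeK | case=> [[]|]].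
Qed.

(** There are three colors in all, so bounds on [h2_coloring] reduce to a case analysis on the
    missing color. *)
Lemma colors_on_le2P c S :
  reflect (exists k, forall e, val e \subset S -> c e != k)
          (#|colors_on c S| <= 2).
Proof.
rewrite -ltnS -card_color -cardsT; apply: (iffP idP) => [ltS|[k nk]].
  have : colors_on c S != setT by apply: contraTneq ltS => ->; rewrite ltnn.
  rewrite -subTset => /subsetPn[k _ kS]; exists k => e eS.
  by apply: contraNneq kS => <-; apply: imset_f; rewrite inE.
apply: proper_card; rewrite properE subsetT; apply/subsetPn; exists k => //.
by apply/imsetP => -[e]; rewrite inE => /nk + kE; rewrite kE eqxx.
Qed.

Definition red_graph c : graph T := [set e | c e == Red].

(** Adjacent ends make the edge red; a red path of length 2 between them forces it to be yellow. *)
Lemma red_dist_le2_not_blue c x y :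
  avoids [:: rrr; rrb] c -> dist_le (red_graph c) 2 x y ->
  forall e, val e = [set x; y] -> c e != Blue.
Proof.
move=> /avoids_rrr_rrbP av /dist_le2P d e exy; case: d => [xy|xy|[z xz zy]].
- by have := edge_neq exy; rewrite xy eqxx.
- by move: xy; rewrite (adjE _ exy) inE => /eqP->.
have [[e1 + E1] [e2 + E2]] := (adj_edge xz, adj_edge zy).
by rewrite !inE => /eqP r1 /eqP r2; rewrite (av _ _ _ _ _ _ E1 E2 exy).
Qed.

Lemma f_graph_red_le c :
  avoids [:: rrr; rrb] c -> f_graph (red_graph c) <= h2_coloring c.
Proof.
move=> av; rewrite geq_max; apply/andP; split; apply/bigmax_leqP => S.
  move=> /forall_inP iS; apply: leq_bigmax_cond; apply/colors_on_le2P.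
  by exists Red => e /iS; rewrite inE.
move=> /forall_inP cS; apply: leq_bigmax_cond; apply/colors_on_le2P.
exists Blue => e /cS; have [x [y exy]] := edge_ends e.
by rewrite (squareE _ exy) => d; apply: red_dist_le2_not_blue av d _ exy.
Qed.

(** Settles the degenerate case: an edgeless red graph does not have clique number 2, hence does not
    compete in the minimum defining [f]. *)
Lemma h2_coloring_no_red c : red_graph c = set0 -> h2_coloring c = #|T|.
Proof.
move=> r0; apply/eqP; rewrite eqn_leq; apply/andP; split.
  by apply/bigmax_leqP => S _; apply: max_card.
rewrite -cardsT; apply: leq_bigmax_cond; apply/colors_on_le2P.
by exists Red => e _; have := in_set0 e; rewrite -r0 inE => ->.
Qed.

Lemma omega_red_graph c :
  avoids [:: rrr; rrb] c -> red_graph c != set0 -> omega (red_graph c) == 2.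
Proof.
move=> /avoids_rrr_rrbP av r0; apply/omega_eq2P; split=> // x y z xy yz.
have [[e1 + E1] [e2 + E2]] := (adj_edge xy, adj_edge yz).
rewrite !inE => /eqP r1 /eqP r2; apply/negP => /adj_edge[e3 + E3].
by rewrite inE (av _ _ _ _ _ _ E1 E2 E3).
Qed.

(** Edges of [G] also lie in [square G]; testing [G] first leaves yellow to the pairs at distance
    exactly 2. *)
Definition square_coloring (G : graph T) : coloring T :=
  [ffun e => if e \in G then Red else if e \in square G then Yellow else Blue].

(** The edge closing a red path of length 2 is not in [G], which has no triangle, but is in
    [square G] through the middle vertex, so it is yellow. *)
Lemma square_coloring_avoids (G : graph T) :
  omega G == 2 -> avoids [:: rrr; rrb] (square_coloring G).
Proof.
case/omega_eq2P => _ tf; apply/avoids_rrr_rrbP => x y z e1 e2 e3 E1 E2 E3.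
rewrite !ffunE; case: ifP => [|_]; last by case: ifP.
rewrite -(adjE _ E1) => xy _; case: ifP => [|_]; last by case: ifP.
rewrite -(adjE _ E2) => yz _; rewrite -(adjE _ E3) (negPf (tf _ _ _ xy yz)).
rewrite (squareE _ E3) (_ : dist_le G 2 x z) //.
by apply/dist_le2P; constructor 3; exists y.
Qed.

End RedGraph.

(* The vertices of S without a smaller neighbour in S form an independent set,
   and sending each other vertex to its smaller neighbour injects the rest of S
   into that set. *)
Lemma matching_le_alpha n (G : graph 'I_n) (S : {set 'I_n}) :
    {in S & &, forall x y z, adj G x y -> adj G x z -> y = z} ->
  #|S| <= 2 * alpha G.
Proof.
move=> mS; pose I := [set x in S | ~~ [exists y in S, adj G x y && (y < x)]].
have indI : independent G I.
  apply: independent_adj => x y; rewrite !inE => /andP[xS nx] /andP[yS ny].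
  apply/negP => xy; have [ltxy|ltyx|/val_inj xyE] := ltngtP x y.
  - by case/existsP: ny; exists x; rewrite xS adj_sym xy.
  - by case/existsP: nx; exists y; rewrite yS xy.
  by have [e _ /edge_neq] := adj_edge xy; rewrite xyE eqxx.
(* The default [x] is never taken on [S :\: I], where a smaller neighbour exists. *)
pose g x := odflt x [pick y in S | adj G x y && (y < x)].
have gP x : x \in S :\: I -> [/\ x \in S, g x \in S, adj G x (g x) & g x < x].
  rewrite !inE; case xS : (x \in S); rewrite ?andbF //= andbT negbK /g.
  case/existsP => y ySx; case: pickP => [z /and3P[]//|/(_ y)].
  by rewrite ySx.
have gI : {in S :\: I &, injective g}.
  move=> x y /gP[xS gxS xg _] /gP[yS _ yg _] gE; apply: (mS (g x)) => //.
    by rewrite adj_sym.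
  by rewrite gE adj_sym.
have gsub : g @: (S :\: I) \subset I.
  apply/subsetP => _ /imsetP[x /gP[xS gxS xg lt] ->]; rewrite inE gxS.
  (* A smaller neighbour [y] of [g x] would equal [x], the only neighbour of [g x] in [S], yet
     [g x < x]. *)
  apply/negP => /exists_inP[y yS /andP[gy lty]].
  have xy : x = y by apply: (mS (g x)) => //; rewrite adj_sym.
  by move: lty; rewrite -xy ltnNge ltnW.
rewrite mul2n -addnn -(cardsID I S) leq_add //.
  apply: leq_trans (leq_bigmax_cond _ indI); rewrite subset_leq_card //.
  exact: subsetIr.
rewrite -(card_in_imset gI).
exact: leq_trans (subset_leq_card gsub) (leq_bigmax_cond _ indI).
Qed.

Lemma h2_square_coloring_le n (G : graph 'I_n) :
  omega G == 2 -> h2_coloring (square_coloring G) <= 2 * f_graph G.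
Proof.
move=> om; apply/bigmax_leqP => S /colors_on_le2P[k nk].
(* Only a set missing yellow needs the factor 2. *)
have mono m : m <= f_graph G -> m <= 2 * f_graph G.
  by move/leq_trans; apply; rewrite leq_pmull.
case: k nk => nk.
- apply/mono/leq_trans/leq_maxl/leq_bigmax_cond/forall_inP => e /nk.
  by rewrite ffunE; case: ifP.
- apply/mono/leq_trans/leq_maxr/leq_bigmax_cond/forall_inP => e /nk.
  rewrite ffunE; case: ifP => [eG _|_]; last by case: ifP.
  have [x [y exy]] := edge_ends e; rewrite (squareE _ exy).
  by apply/dist_le2P; constructor 2; rewrite (adjE _ exy).
suff matchS : #|S| <= 2 * alpha G.
  by apply: leq_trans matchS _; rewrite leq_mul2l leq_maxl.
(* Two distinct neighbours [y], [z] of [x] in [S] are non-adjacent and at distance 2, so their edge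
   would be yellow. *)
apply: matching_le_alpha => x y z xS yS zS xy xz; apply/eqP.
apply/negPn/negP => /edgeP[e eyz]; have [_ tf] := omega_eq2P _ om.
have : square_coloring G e != Yellow.
  by apply: nk; rewrite eyz subUset !sub1set yS.
rewrite ffunE -(adjE G eyz) (negPf (tf y x z _ xz)) 1?adj_sym //.
rewrite (squareE _ eyz) (_ : dist_le G 2 y z) //.
by apply/dist_le2P; constructor 3; exists x; rewrite // adj_sym.
Qed.

Theorem lemma2p4 (n : nat) (hn : 2 <= n) :
  f n <= h2 n [:: rrr; rrb] <= 2 * f n.
Proof.
(* With [G] and [c] attaining the two minima, the lower bound tests [f] on the red graph of [c] and
   the upper bound tests [h2] on the square coloring of [G]. *)
have [G omG [fG minG]] := f_attained hn.
have [c + [hc minc]] := h2_attained (Forb_rrr_rrb_neq0 n).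
rewrite inE => av; apply/andP; split.
  rewrite hc; have [r0|r0] := eqVneq (red_graph c) set0.
    rewrite h2_coloring_no_red // fG geq_max.
    by apply/andP; split; apply/bigmax_leqP => S _; apply: max_card.
  rewrite fG; apply: leq_trans (f_graph_red_le av).
  exact/minG/omega_red_graph.
rewrite hc fG; apply: leq_trans (h2_square_coloring_le omG).
by apply: minc; rewrite inE square_coloring_avoids.
Qed.
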